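(* Fix $\vartheta\in\mathbb{C}$, let $r_1,r_2$ be the two roots (listed with multiplicity, so $r_1=r_2=-1$ if $\vartheta=0$) of $\vartheta-(\mathtt{h}+1)^2$, let $\omega=3+\max(\mathrm{Re}\, r_1,\mathrm{Re}\, r_2)$ and $\mathbb{C}_\omega=\{z\in\mathbb{C}: \mathrm{Re}\,z\in[\omega,\omega+2)\}$. Let $u=c\prod_{t\in\mathbb{C}_\omega}(\mathtt{h}-t)^{\mathtt{m}(t)}$ with $c\in\mathbb{C}^\times$ and $\mathtt{m}:\mathbb{C}_\omega\to\mathbb{Z}$ of finite support. Let $K_u\subset\mathbb{C}(\mathtt{h})$ be the $\mathbb{C}$-linear span of: (i) $\mathbb{C}[\mathtt{h}]$; (ii) for each $s\in\mathbb{C}_\omega$ with $\mathtt{m}(s)<0$, the elements $\frac{1}{(\mathtt{h}-s-2i)^k}$ with $i\in\mathbb{Z}_{\geq0}$ and $1\leq k\leq-\mathtt{m}(s)$; (iii) for each $s\in\mathbb{C}_\omega$ with $\mathtt{m}(s)>0$, the elements $\frac{1}{(\mathtt{h}-s+2i)^k}$ with $i\in\mathbb{Z}_{>0}$ and $1\leq k\leq \mathtt{m}(s)-|\{j\in\{1,2\}: r_j\in\{s-4,s-6,\dots,s-2i\}\}|$. Then $K_u=L_u$.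
   Context: $\mathfrak{g}=\mathfrak{sl}_2(\mathbb{C})$ with basis $\mathtt{e},\mathtt{f},\mathtt{h}$, $[\mathtt{h},\mathtt{e}]=2\mathtt{e}$, $[\mathtt{h},\mathtt{f}]=-2\mathtt{f}$, $[\mathtt{e},\mathtt{f}]=\mathtt{h}$; Casimir element $\mathtt{c}=(\mathtt{h}+1)^2+4\mathtt{f}\mathtt{e}$; $U_\vartheta=U(\mathfrak{g})/U(\mathfrak{g})(\mathtt{c}-\vartheta)$. Let $\Bbbk=\mathbb{C}(\mathtt{h})$, $\sigma$ the automorphism of $\Bbbk$ fixing $\mathbb{C}$ with $\sigma(\mathtt{h})=\mathtt{h}-2$, and $R=\Bbbk[x,x^{-1},\sigma]$ (skew Laurent polynomials: $xr=\sigma(r)x$ for $r\in\Bbbk$). The assignment $\mathtt{e}\mapsto x$, $\mathtt{f}\mapsto\frac{\vartheta-(\mathtt{h}+1)^2}{4}x^{-1}$, $\mathtt{h}\mapsto\mathtt{h}$ gives an injective algebra homomorphism $U_\vartheta\to R$. $N_u$ is $\Bbbk$ with the $R$-module structure where $\Bbbk$ acts by multiplication and $x\cdot b=\sigma(b)u$; as a $U_\vartheta$-module, $\mathtt{h}$ acts by multiplication, $\mathtt{e}\cdot b=\sigma(b)u$ and $\mathtt{f}\cdot b=\frac{\vartheta-(\mathtt{h}+1)^2}{4}\cdot\frac{\sigma^{-1}(b)}{\sigma^{-1}(u)}$. It is known that $N_u$, viewed as a $U_\vartheta$-module, has a unique simple submodule; this is denoted $L_u$ (and $K_u$ is regarded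 as a subspace of $N_u=\mathbb{C}(\mathtt{h})$). *)

(* Defs.v *)
From HB Require Import structures.
From mathcomp Require Import all_boot all_order all_algebra.
From mathcomp Require Import generic_quotient fraction.
From mathcomp Require Import complex.
From mathcomp Require Import reals.
Set Implicit Arguments. Unset Strict Implicit. Unset Printing Implicit Defensive.
Import Order.TTheory GRing.Theory Num.Theory.
Local Open Scope ring_scope.

Section Defs.
Context {C : numClosedFieldType}.

Definition Fh := {fraction {poly C}}.
Definition polyF (p : {poly C}) : Fh := tofrac p.
Definition cstF (c : C) : Fh := polyF c%:P.
Definition hF : Fh := polyF 'X.

Definition shiftF (a : C) (x : Fh) : Fh :=
  let r := repr x in
  polyF (\n_r \Po ('X + a%:P)) / polyF (\d_r \Po ('X + a%:P)).

Definition sigmaF (x : Fh) : Fh := shiftF (-2) x.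
Definition sigmaFinv (x : Fh) : Fh := shiftF 2 x.

Definition act_h (x : Fh) : Fh := hF * x.
Definition act_e (u x : Fh) : Fh := sigmaF x * u.
Definition act_f (theta : C) (u x : Fh) : Fh :=
  (cstF theta - (hF + 1) ^+ 2) / 4%:R * (sigmaFinv x / sigmaFinv u).

(* U_theta-submodules of N_u: C-subspaces stable under e, f, h
   (these generate U_theta as an algebra) *)
Definition is_submodule (theta : C) (u : Fh) (S : Fh -> Prop) : Prop :=
  S 0 /\
  (forall x y, S x -> S y -> S (x + y)) /\
  (forall c x, S x -> S (cstF c * x)) /\
  (forall x, S x -> S (act_h x)) /\
  (forall x, S x -> S (act_e u x)) /\
  (forall x, S x -> S (act_f theta u x)).

Definition is_simple_submodule (theta : C) (u : Fh) (S : Fh -> Prop) : Prop :=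
  [/\ is_submodule theta u S,
      (exists x, S x /\ x != 0) &
      (forall T, is_submodule theta u T -> (forall x, T x -> S x) ->
         (forall x, T x -> x = 0) \/ (forall x, S x -> T x))].

Definition spanF (G : Fh -> Prop) (b : Fh) : Prop :=
  exists l : seq (C * Fh),
    (forall cg, cg \in l -> G cg.2) /\ b = \sum_(cg <- l) cstF cg.1 * cg.2.

Definition in_Comega (omega z : C) : bool := (omega <= 'Re z) && ('Re z < omega + 2%:R).

Definition nroots_between (r1 r2 s : C) (i : nat) : nat :=
  count (fun r => has (fun l => r == s - (2 * l)%:R) (iota 2 i.-1)) [:: r1; r2].

Definition Ku_gen (m : C -> int) (r1 r2 : C) (b : Fh) : Prop :=
  (exists p : {poly C}, b = polyF p)
  \/ (exists s (i k : nat), m s < 0 /\ (1 <= k)%N /\ k%:Z <= - m s /\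
        b = ((hF - cstF s - cstF (2 * i)%:R) ^+ k)^-1)
  \/ (exists s (i k : nat), 0 < m s /\ (0 < i)%N /\ (1 <= k)%N /\
        k%:Z <= m s - (nroots_between r1 r2 s i)%:Z /\
        b = ((hF - cstF s + cstF (2 * i)%:R) ^+ k)^-1).

Definition Ku (m : C -> int) (r1 r2 : C) : Fh -> Prop := spanF (Ku_gen m r1 r2).

End Defs.

(* Main.v *)
(* Call [b] polar when its pole order at each [z] is at most [d z], where [d] is
   read off from (i)-(iii).  A [C[h]]-submodule of [C(h)] that contains, for
   every [z], an element with a pole of order exactly [d z] at [z] contains all
   polar elements: the ideal of the [p] with [p * b] in the submodule has no
   common zero.  Hence [K_u] is the set of polar elements.  If [t z] is the
   largest pole order at [z] in a submodule [T], the actions of [e] and [f] give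
     [t (z + 2) >= t z - m (z + 2)] and
     [t z >= t (z + 2) + m (z + 2) - ord_z (theta - (h + 1)^2)].
   The function [d] satisfies both, so [K_u] is a submodule; a nonzero [T]
   contains a nonzero polynomial, so [t >= 0] far out on every chain [z + 2 Z],
   and following the inequalities inwards from both ends gives [t >= d].  So
   [K_u] is contained in every nonzero submodule. *)
Require Import Defs.
From HB Require Import structures.
From mathcomp Require Import all_boot all_order all_algebra.
From mathcomp Require Import generic_quotient fraction.
From mathcomp Require Import complex.
From mathcomp Require Import reals.
From mathcomp Require Import boolp ring zify.
Import Order.TTheory GRing.Theory Num.Theory.
Local Open Scope ring_scope.

HB.instance Definition _ (C : numClosedFieldType) :=
  GRing.RMorphism.copy (@polyF C) (@FracField.tofrac {poly C}).

Lemma cross_cancel (F : fieldType) (a b c d x : F) :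
  b != 0 -> d != 0 -> c * b * (a / b * x) = a * d * (c / d * x).
Proof. by move=> b0 d0; field; rewrite b0 d0. Qed.

(** * Orders and poles of rational functions; from local to global membership *)

Section Orders.
Context {C : numClosedFieldType}.
Implicit Types (z w a : C) (p q : {poly C}) (b x y : @Fh C) (n k : int).

Lemma polyF_eq0 p : (polyF p == 0) = (p == 0).
Proof. exact: tofrac_eq0. Qed.

Lemma cstFD z w : cstF (z + w) = cstF z + cstF w :> @Fh C.
Proof. by rewrite /cstF !rmorphD. Qed.

Lemma cstFN z : cstF (- z) = - cstF z :> @Fh C.
Proof. by rewrite /cstF !rmorphN. Qed.

Lemma cstFM z w : cstF (z * w) = cstF z * cstF w :> @Fh C.
Proof. by rewrite /cstF !rmorphM. Qed.

Lemma linF z : hF - cstF z = polyF ('X - z%:P) :> @Fh C.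
Proof. by rewrite rmorphB. Qed.

Lemma linF_neq0 z : hF - cstF z != 0 :> @Fh C.
Proof. by rewrite linF polyF_eq0 polyXsubC_eq0. Qed.

Lemma neq0_horner p z : p.[z] != 0 -> p != 0.
Proof. by apply: contraNneq => ->; rewrite horner0. Qed.

Lemma polyF_horner_neq0 p z : p.[z] != 0 -> polyF p != 0.
Proof. by rewrite polyF_eq0; apply: neq0_horner. Qed.

Lemma fracE b :
  [/\ \d_(repr b) != 0 & b = polyF \n_(repr b) / polyF \d_(repr b)].
Proof.
have d0 : \d_(repr b) != 0 by exact: denom_ratioP.
split=> //; apply: (canRL (mulfK _)); first by rewrite polyF_eq0.
rewrite /polyF -[X in X * _](reprK b); move: (repr b) d0 => x d0.
rewrite -[_ * _]/(FracField.mul _ _) !piE /FracField.mulf.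
apply/eqmodP; rewrite /= FracField.equivfE !numden_Ratio ?mulr1 ?oner_eq0 //=.
by rewrite mulrC.
Qed.

Lemma fracP b : exists p q, q != 0 /\ b = polyF p / polyF q.
Proof. by have [d0 ->] := fracE b; do 2 eexists; split; first exact: d0. Qed.

Lemma comp_shift_neq0 a q : q != 0 -> q \Po ('X + a%:P) != 0.
Proof.
move=> q0; rewrite comp_poly2_eq0 //.
by rewrite size_XaddC.
Qed.

(** [shiftF] computes on one chosen representative; any other gives the same value, because
    substituting [X + a] preserves the cross-multiplied equality. *)
Lemma shiftFE a p q : q != 0 ->
  shiftF a (polyF p / polyF q) =
  polyF (p \Po ('X + a%:P)) / polyF (q \Po ('X + a%:P)).
Proof.
move=> q0; rewrite /shiftF; have [d0 E] := fracE (polyF p / polyF q).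
set nn := \n_ _ in E *; set dd := \d_ _ in d0 E *.
have dn0 := comp_shift_neq0 a _ d0; have qn0 := comp_shift_neq0 a _ q0.
move/eqP: E; rewrite eqr_div ?polyF_eq0 // -!rmorphM /= => /eqP.
move/eqP; rewrite tofrac_eq => /eqP E.
by apply/eqP; rewrite eqr_div ?polyF_eq0 // -!rmorphM /= E.
Qed.

Lemma shiftFM a x y : shiftF a (x * y) = shiftF a x * shiftF a y.
Proof.
have [p [q [q0 ->]]] := fracP x; have [p' [q' [q0' ->]]] := fracP y.
rewrite !shiftFE // mulf_div -!rmorphM /= shiftFE ?mulf_neq0 //.
by rewrite !comp_polyM !rmorphM /= mulf_div.
Qed.

Lemma shiftF_poly a p : shiftF a (polyF p) = polyF (p \Po ('X + a%:P)).
Proof.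
rewrite -[polyF p]divr1 -(rmorph1 (@polyF C)) shiftFE ?oner_eq0 //.
by rewrite -polyC1 comp_polyC polyC1 rmorph1 divr1.
Qed.

Lemma shiftF0 a : shiftF a 0 = 0 :> @Fh C.
Proof. by rewrite -(rmorph0 (@polyF C)) shiftF_poly comp_poly0. Qed.

Lemma shiftF1 a : shiftF a 1 = 1 :> @Fh C.
Proof. by rewrite -(rmorph1 (@polyF C)) shiftF_poly -polyC1 comp_polyC. Qed.

Lemma shiftFV a x : shiftF a x^-1 = (shiftF a x)^-1.
Proof.
have [->|x0] := eqVneq x 0; first by rewrite invr0 shiftF0 invr0.
have E : shiftF a x * shiftF a x^-1 = 1 by rewrite -shiftFM mulfV ?shiftF1.
have s0 : shiftF a x != 0.
  by apply: contra_eq_neq E => ->; rewrite mul0r eq_sym oner_eq0.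
by apply: (mulfI s0); rewrite E mulfV.
Qed.

Lemma shiftFX a x n : shiftF a (x ^ n) = shiftF a x ^ n.
Proof.
have H (k : nat) : shiftF a (x ^+ k) = shiftF a x ^+ k.
  by elim: k => [|k IH]; rewrite ?expr0 ?shiftF1 // !exprS shiftFM IH.
by case: n => k; rewrite ?NegzE -?exprnN -?exprnP ?shiftFV H.
Qed.

Lemma shiftF_lin a z : shiftF a (hF - cstF z) = hF - cstF (z - a) :> @Fh C.
Proof.
rewrite !linF shiftF_poly comp_polyB comp_polyX comp_polyC polyCB.
by congr polyF; ring.
Qed.

Lemma horner_shift a p z : (p \Po ('X + a%:P)).[z - a] = p.[z].
Proof. by rewrite horner_comp !hornerE subrK. Qed.

Definition has_ord z n b := exists p q,
  [/\ p.[z] != 0, q.[z] != 0 & b = polyF p / polyF q * (hF - cstF z) ^ n].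

(** Unlike in [has_ord], the numerator may vanish at [z], so the zero function qualifies and sums
    stay inside. *)
Definition pole_le z n b := exists p q,
  q.[z] != 0 /\ b = polyF p / polyF q * (hF - cstF z) ^ (- n).

Lemma has_ordM z n k x y :
  has_ord z n x -> has_ord z k y -> has_ord z (n + k) (x * y).
Proof.
move=> [p [q [p0 q0 ->]]] [p' [q' [p0' q0' ->]]]; exists (p * p'), (q * q').
rewrite !hornerM !mulf_neq0 //; split=> //.
by rewrite expfzDr ?linF_neq0 // !rmorphM /= -mulf_div mulrACA.
Qed.

Lemma has_ordV z n x : has_ord z n x -> has_ord z (- n) x^-1.
Proof.
move=> [p [q [p0 q0 ->]]]; exists q, p; split=> //.
by rewrite invfM invf_div invr_expz.
Qed.

Lemma has_ord_poly z p : p.[z] != 0 -> has_ord z 0 (polyF p).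
Proof.
move=> p0; exists p, 1; rewrite hornerC oner_eq0; split=> //.
by rewrite rmorph1 divr1 mulr1.
Qed.

Lemma has_ord_lin z w : has_ord z (w == z)%:Z (hF - cstF w).
Proof.
have [->|wz] := eqVneq w z; last first.
  by rewrite linF; apply: has_ord_poly; rewrite !hornerE subr_eq0 eq_sym.
exists 1, 1; rewrite !hornerC !oner_eq0; split=> //.
by rewrite rmorph1 divr1 mul1r expr1z.
Qed.

Lemma has_ordX z n k x : has_ord z n x -> has_ord z (k * n) (x ^ k).
Proof.
have H (i : nat) : has_ord z n x -> has_ord z (i%:Z * n) (x ^+ i).
  move=> xn; elim: i => [|i IH].
    rewrite mul0r expr0 -(rmorph1 (@polyF C)); apply: has_ord_poly.
    by rewrite hornerC oner_eq0.
  by rewrite exprS -addn1 PoszD mulrDl mul1r addrC; apply: has_ordM.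
case: k => k xn; first by rewrite -exprnP; apply: H.
by rewrite NegzE -exprnN mulNr; apply: has_ordV; apply: H.
Qed.

Lemma has_ord_shift a z n x : has_ord z n x -> has_ord (z - a) n (shiftF a x).
Proof.
move=> [p [q [p0 q0 ->]]]; exists (p \Po ('X + a%:P)), (q \Po ('X + a%:P)).
rewrite !horner_shift; split=> //.
by rewrite shiftFM shiftFX shiftF_lin shiftFE // (neq0_horner _ z).
Qed.

Lemma has_ord_prod (I : Type) z (r : seq I) (F : I -> @Fh C) (f : I -> int) :
  (forall i, has_ord z (f i) (F i)) ->
  has_ord z (\sum_(i <- r) f i) (\prod_(i <- r) F i).
Proof.
move=> H; elim: r => [|i r IH]; last by rewrite !big_cons; apply: has_ordM.
rewrite !big_nil -(rmorph1 (@polyF C)); apply: has_ord_poly.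
by rewrite hornerC oner_eq0.
Qed.

Lemma pole_leM z n k x y :
  pole_le z n x -> pole_le z k y -> pole_le z (n + k) (x * y).
Proof.
move=> [p [q [q0 ->]]] [p' [q' [q0' ->]]]; exists (p * p'), (q * q').
rewrite !hornerM !mulf_neq0 //; split=> //.
by rewrite opprD expfzDr ?linF_neq0 // !rmorphM /= -mulf_div mulrACA.
Qed.

Lemma pole_leD z n x y : pole_le z n x -> pole_le z n y -> pole_le z n (x + y).
Proof.
move=> [p [q [q0 ->]]] [p' [q' [q0' ->]]]; exists (p * q' + p' * q), (q * q').
rewrite !hornerM !mulf_neq0 //; split=> //.
rewrite -mulrDl !(rmorphD, rmorphM) /= addf_div //;
  exact: (polyF_horner_neq0 _ z).
Qed.

Lemma pole_le_poly z p : pole_le z 0 (polyF p).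
Proof.
exists p, 1; rewrite hornerC oner_eq0; split=> //.
by rewrite rmorph1 divr1 mulr1.
Qed.

Lemma has_ord_pole z n x : has_ord z n x -> pole_le z (- n) x.
Proof. by move=> [p [q [p0 q0 ->]]]; exists p, q; rewrite opprK. Qed.

Lemma has_ord_linX z n : has_ord z n ((hF - cstF z) ^ n).
Proof. by have := has_ordX z _ n _ (has_ord_lin z z); rewrite eqxx mulr1. Qed.

Lemma le_int_ex n k : n <= k -> exists i : nat, k = n + i%:Z.
Proof. by move=> nk; exists (absz (k - n)); lia. Qed.

Lemma pole_leW z n k x : n <= k -> pole_le z n x -> pole_le z k x.
Proof.
move=> nk xn.
have [i ki] := le_int_ex _ _ nk.
have [p [q [q0 ->]]] := xn; exists (p * ('X - z%:P) ^+ i), q; split=> //.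
have -> : - n = i%:Z - k by lia.
rewrite rmorphM rmorphXn /= -linF exprnP expfzDr ?linF_neq0 //.
by rewrite !mulrA; congr (_ * _); rewrite mulrAC.
Qed.

Lemma pole_le_shift a z n x : pole_le z n x -> pole_le (z - a) n (shiftF a x).
Proof.
move=> [p [q [q0 ->]]]; exists (p \Po ('X + a%:P)), (q \Po ('X + a%:P)).
rewrite !horner_shift; split=> //.
by rewrite shiftFM shiftFX shiftF_lin shiftFE // (neq0_horner _ z).
Qed.

Definition is_hsubmodule (M : @Fh C -> Prop) :=
  [/\ M 0, forall x y, M x -> M y -> M (x + y) &
      forall p x, M x -> M (polyF p * x)].

(** [n] counts pole order, so a negative [n] means a zero; such values occur while walking along a
    chain. *)
Definition reach (M : @Fh C -> Prop) z n := exists2 b, has_ord z (- n) b & M b.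

Lemma reachW M z n k : is_hsubmodule M -> k <= n -> reach M z n -> reach M z k.
Proof.
move=> [_ _ Mp] kn [b bn Mb].
have [i ki] := le_int_ex _ _ kn.
exists (polyF (('X - z%:P) ^+ i) * b); last exact: Mp.
rewrite rmorphXn /= -linF exprnP.
have := has_ordM _ _ _ _ _ (has_ord_linX z i) bn.
by congr has_ord; lia.
Qed.

(** Descent on the size: a root of [p] is missed by some [q] in [I], so a gcd of [p] and [q] lies in
    [I] and is strictly smaller than [p]. *)
Lemma ideal_full (I : {poly C} -> Prop) p :
  (forall p q, I p -> I q -> I (p + q)) -> (forall p q, I q -> I (p * q)) ->
  (forall z, exists2 q, I q & q.[z] != 0) -> p != 0 -> I p -> I 1.
Proof.
move=> ID IM Iz; have [n] := ubnP (size p); elim: n p => // n IH p.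
rewrite ltnS => pn p0 Ip.
have [p1|p1] := eqVneq (size p) 1%N.
  have /size_poly1P [c c0 pc] : size p == 1%N by rewrite p1.
  by have := IM (c^-1)%:P _ Ip; rewrite pc -polyCM mulVf.
have [z pz] := closed_rootP p p1.
have [q Iq qz] := Iz z.
have [[s t] /= st] := Bezoutp p q.
set g := s * p + t * q in st.
have Ig : I g by apply: ID; apply: IM.
have gz : ~~ root g z.
  apply: contra qz => gz; rewrite -/(root q z).
  by apply: root_dvdp gz; rewrite (eqp_dvdl _ st) dvdp_gcdr.
have gp : g %| p by rewrite (eqp_dvdl _ st) dvdp_gcdl.
have g0 : g != 0 by apply: contraNneq gz => ->; rewrite root0.
apply: (IH g) => //; apply: leq_trans pn.
(* Equal sizes would make [g] an associate of [p], which vanishes at [z]. *)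
rewrite ltn_neqAle dvdp_leq // andbT dvdp_size_eqp //.
by apply: contra gz => gp'; rewrite (eqp_root gp').
Qed.

Lemma local_global M (d : C -> int) b : is_hsubmodule M ->
  (forall z, reach M z (d z)) -> (forall z, pole_le z (d z) b) -> M b.
Proof.
move=> [M0 MD Mp] Mr bd; pose I p := M (polyF p * b).
suff : I 1 by rewrite /I rmorph1 mul1r.
have Iz z : exists2 s, I s & s.[z] != 0.
  have [x [p1 [q1 [p10 q10 xE]]] Mx] := Mr z.
  have [p2 [q2 [q20 bE]]] := bd z.
  (* Both functions carry the same power of [h - z], so [p1 * q2 * b = p2 * q1 * x], and [x] is in
     [M]. *)
  exists (p1 * q2); last by rewrite hornerM mulf_neq0.
  have := Mp (p2 * q1) _ Mx; rewrite /I xE bE !rmorphM /=.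
  by rewrite (@cross_cancel _ _ _ _ (polyF q2)) // (polyF_horner_neq0 _ z).
(* The point 0 is arbitrary: it supplies a nonzero member of [I] to start the descent. *)
have [r Ir rz] := Iz 0.
apply: (ideal_full I r) => //; rewrite /I.
- by move=> s t; rewrite rmorphD mulrDl; apply: MD.
- by move=> s t; rewrite rmorphM -mulrA; apply: Mp.
- exact: neq0_horner rz.
Qed.

End Orders.

(** * Half-chains with step 2 and the strip of representatives *)

Section Chains.
Context {C : numClosedFieldType}.
Implicit Types (z w s t x y : C).

(** Boolean, by classical logic, so that it can serve as a 0/1 indicator in sums. *)
Definition inN x y : bool := `[< exists k : nat, x = y + (2 * k)%:R >].

Lemma inNP x y : reflect (exists k : nat, x = y + (2 * k)%:R) (inN x y).
Proof. exact: asboolP. Qed.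

Lemma inN22 x y : inN (x + 2%:R) (y + 2%:R) = inN x y.
Proof.
apply/inNP/inNP => -[k E]; exists k; last by rewrite E addrAC.
by apply: (addIr 2%:R); rewrite E addrAC.
Qed.

Lemma inN_refl x : inN x x.
Proof. by apply/inNP; exists 0%N; rewrite muln0 addr0. Qed.

Lemma inN_step x y : inN x (y + 2%:R) -> inN x y.
Proof.
by move=> /inNP[k ->]; apply/inNP; exists k.+1; rewrite -addrA -natrD -mulnS.
Qed.

Lemma addr_nat_neq x (k : nat) : (0 < k)%N -> x != x + k%:R.
Proof.
by move=> k0; rewrite -{1}[x]addr0 (inj_eq (addrI x)) eq_sym pnatr_eq0 -lt0n.
Qed.

(** Splits off the endpoint of a half-chain; the recurrences for [Asum], [Bsum] and [Nroots] all
    come from it. *)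
Lemma inNS x y : (inN x y)%:Z = (x == y)%:Z + (inN x (y + 2%:R))%:Z.
Proof.
have [->|xy] := eqVneq x y.
  rewrite inN_refl; case: inNP => // -[k /eqP].
  by rewrite -addrA -natrD (negbTE (addr_nat_neq _ _ _)).
rewrite add0r; congr (nat_of_bool _)%:Z; apply/idP/idP; last exact: inN_step.
move=> /inNP[[|k] E]; first by rewrite E muln0 addr0 eqxx in xy.
by apply/inNP; exists k; rewrite E -addrA -natrD -mulnS.
Qed.

(** The thresholds of the single points are merged by taking their maximum; this gives a starting
    point far out on a chain. *)
Lemma eventually_notin (P : nat -> C -> bool) (ws : seq C) :
  (forall w, exists K, forall k, (K <= k)%N -> ~~ P k w) ->
  exists K, forall k, (K <= k)%N -> forall w, w \in ws -> ~~ P k w.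
Proof.
move=> H; elim: ws => [|w ws [K IH]]; first by exists 0%N.
have [K' HK'] := H w; exists (maxn K K') => k; rewrite geq_max => /andP[k1 k2] x.
by rewrite inE => /orP[/eqP->|]; [apply: HK' | apply: IH].
Qed.

Lemma inN_left z w :
  exists K, forall k, (K <= k)%N -> ~~ inN (z - (2 * k)%:R) w.
Proof.
have [/inNP[j ->]|zw] := boolP (inN z w); last first.
  exists 0%N => k _; apply: contra zw => /inNP[j E]; apply/inNP; exists (j + k)%N.
  by rewrite mulnDr natrD addrA -E subrK.
exists j.+1 => k jk; apply/inNP => -[l E].
have /addrI/eqP : w + (2 * j)%:R = w + (2 * (l + k))%:R.
  by rewrite mulnDr natrD addrA -E subrK.
by rewrite eqr_nat; lia.
Qed.

Lemma inN_right z w :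
  exists K, forall k, (K <= k)%N -> ~~ inN w (z + (2 * k)%:R).
Proof.
have [K HK] := inN_left w z; exists K => k /HK; apply: contra => /inNP[j ->].
by apply/inNP; exists j; rewrite addrAC addrK.
Qed.

Lemma Re_addn z (k : nat) : 'Re (z + k%:R) = 'Re z + k%:R.
Proof. by rewrite raddfD /= (Creal_ReP k%:R _) ?realn. Qed.

Lemma Re_lt_neq x y (k : nat) : 'Re y < 'Re x -> y != x + k%:R.
Proof.
apply: contraTneq => ->; rewrite Re_addn -real_leNgt ?rpredD ?Creal_Re ?realn //.
by rewrite lerDl ler0n.
Qed.

(** The strip is half open of width 2: if [k > l], then [t = s + 2 (k - l)] would have real part at
    least [omega + 2]. *)
Lemma Comega_inj omega s t (k l : nat) :
  in_Comega omega s -> in_Comega omega t ->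
  s + (2 * k)%:R = t + (2 * l)%:R -> k = l /\ s = t.
Proof.
wlog kl : s t k l / (l <= k)%N => [H|].
  move=> so to E; have [kl|/ltnW kl] := leqP l k; first exact: H.
  by have [] := H t s l k kl to so (esym E).
move=> /andP[os _] /andP[_ to] E.
have {E} tE : t = s + (2 * (k - l))%:R.
  by apply: (addIr (2 * l)%:R); rewrite -E -addrA -natrD -mulnDr subnK.
move: to; rewrite tE Re_addn; case: (posnP (k - l)%N) => [kl0 _|kl0].
  by split; [lia | rewrite kl0 muln0 addr0].
move=> H; have := le_lt_trans (lerD os (lexx _)) H; rewrite ltrD2l ltr_nat; lia.
Qed.

End Chains.

(** * The pole bound attached to [m] and the roots *)

Section PoleBound.
Context {C : numClosedFieldType}.
Context (r1 r2 : C) (m : C -> int) (supp : seq C).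
Implicit Types (z s : C).

(* [inN z s] says that [z] is in [s + 2 N].  As [supp] meets each class modulo 2
   at most once, [Asum z] and [Bsum z] have at most one nonzero term in all. *)
Definition Asum z : int := \sum_(s <- supp) m s * (inN z s)%:Z.
Definition Bsum z : int := \sum_(s <- supp) m s * (inN s (z + 2%:R))%:Z.
(** Zeros of [theta - (h + 1)^2] at or to the right of [z] on its chain: each costs one pole order
    when [f] carries an element leftwards to [z]. *)
Definition Nroots z : int := (inN r1 z)%:Z + (inN r2 z)%:Z.
Definition ordP z : int := (r1 == z)%:Z + (r2 == z)%:Z.
(* The largest pole order at [z] of an element of [K_u]. *)
Definition bound z : int := Num.max 0 (Num.max (- Asum z) (Bsum z - Nroots z)).

Lemma Nroots_ge0 z : 0 <= Nroots z.
Proof. by rewrite /Nroots; lia. Qed.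

Lemma ordP_ge0 z : 0 <= ordP z.
Proof. by rewrite /ordP; lia. Qed.

Lemma bound_ge0 z : 0 <= bound z.
Proof. by rewrite /bound; lia. Qed.

Lemma Nroots_rec z : Nroots z = ordP z + Nroots (z + 2%:R).
Proof. by rewrite /Nroots /ordP inNS [(inN r2 z)%:Z]inNS addrACA. Qed.

End PoleBound.

(** * Effect of [e] and [f] on orders and poles *)

Section Actions.
Context {C : numClosedFieldType}.
Implicit Types (z : C) (n k : int) (u x : @Fh C).

Lemma has_ord_cst z (c : C) : c != 0 -> has_ord z 0 (cstF c).
Proof. by move=> c0; apply: has_ord_poly; rewrite hornerC. Qed.

(** Replacing [h] by [h - 2] moves the order at [z] to [z + 2], where the order of [u] is added. *)
Lemma has_ord_e u z n k x : has_ord (z + 2%:R) k u -> has_ord z n x ->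
  has_ord (z + 2%:R) (n + k) (act_e u x).
Proof.
move=> uk xn; apply: has_ordM => //.
by have := has_ord_shift (-2) _ _ _ xn; rewrite opprK.
Qed.

Lemma pole_le_e u z n k x : has_ord (z + 2%:R) k u -> pole_le z n x ->
  pole_le (z + 2%:R) (n - k) (act_e u x).
Proof.
move=> uk xn; apply: pole_leM; last exact: has_ord_pole.
by have := pole_le_shift (-2) _ _ _ xn; rewrite opprK.
Qed.

Context (theta r1 r2 : C).
Context (roots12 : theta%:P - ('X + 1) ^+ 2 = - (('X - r1%:P) * ('X - r2%:P))).

(** The coefficient is [-1/4] times [(h - r1) (h - r2)], so its order counts the roots equal to
    [z]. *)
Lemma has_ord_casimir z :
  has_ord z (ordP r1 r2 z) ((cstF theta - (hF + 1) ^+ 2) / 4%:R).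
Proof.
have -> : (cstF theta - (hF + 1) ^+ 2) / 4%:R =
    cstF (- 4%:R^-1) * ((hF - cstF r1) * (hF - cstF r2)) :> @Fh C.
  have -> : (4%:R : @Fh C) = cstF 4%:R by rewrite /cstF !rmorph_nat.
  have -> : cstF theta - (hF + 1) ^+ 2 =
      - ((hF - cstF r1) * (hF - cstF r2)) :> @Fh C.
    have := congr1 polyF roots12.
    by rewrite !(rmorphB, rmorphN, rmorphM, rmorphXn, rmorphD, rmorph1).
  have -> : cstF (- 4%:R^-1) = - (cstF 4%:R)^-1 :> @Fh C.
    rewrite cstFN; congr (- _); apply: (@mulfI _ (cstF 4%:R)).
      by rewrite /cstF polyF_eq0 polyC_eq0 pnatr_eq0.
    rewrite -cstFM !mulfV ?pnatr_eq0 // ?rmorph1 /cstF ?rmorph1 //.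
    by rewrite polyF_eq0 polyC_eq0 pnatr_eq0.
  by rewrite !mulNr mulrC.
rewrite -[ordP _ _ _]add0r; apply: has_ordM.
  by apply: has_ord_cst; rewrite oppr_eq0 invr_eq0 pnatr_eq0.
by apply: has_ordM; apply: has_ord_lin.
Qed.

Lemma has_ord_f u z n k x : has_ord (z + 2%:R) k u -> has_ord (z + 2%:R) n x ->
  has_ord z (ordP r1 r2 z + (n - k)) (act_f theta u x).
Proof.
move=> uk xn; apply: has_ordM; first exact: has_ord_casimir.
have := has_ord_shift 2 _ _ _ uk; have := has_ord_shift 2 _ _ _ xn.
by rewrite !addrK => xn' uk'; apply: has_ordM => //; apply: has_ordV.
Qed.

Lemma pole_le_f u z n k x : has_ord (z + 2%:R) k u -> pole_le (z + 2%:R) n x ->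
  pole_le z (n + k - ordP r1 r2 z) (act_f theta u x).
Proof.
move=> uk xn; rewrite addrC; apply: pole_leM.
  exact: has_ord_pole (has_ord_casimir z).
have := has_ord_shift 2 _ _ _ uk; have := pole_le_shift 2 _ _ _ xn.
rewrite !addrK => xn' uk'; apply: pole_leM => //.
by rewrite -[k]opprK; apply: has_ord_pole; apply: has_ordV.
Qed.

Lemma submodule_hsubmodule u (T : @Fh C -> Prop) :
  is_submodule theta u T -> is_hsubmodule T.
Proof.
move=> [T0 [TD [Tc [Th _]]]]; split=> // p x Tx.
elim/poly_ind: p => [|p c IH]; first by rewrite rmorph0 mul0r.
rewrite rmorphD rmorphM /= mulrDl -mulrA mulrCA.
by apply: TD; [apply: Th | apply: Tc].
Qed.

End Actions.

(** * Linear spans *)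

Section Span.
Context {C : numClosedFieldType}.
Implicit Types (G Q : @Fh C -> Prop) (x y : @Fh C).

Lemma spanF_gen G x : G x -> spanF G x.
Proof.
move=> Gx; exists [:: (1, x)]; split; first by move=> cg; rewrite inE => /eqP->.
by rewrite big_seq1 /cstF !rmorph1 mul1r.
Qed.

Lemma spanF0 G : spanF G 0.
Proof. by exists [::]; rewrite big_nil. Qed.

Lemma spanFD G x y : spanF G x -> spanF G y -> spanF G (x + y).
Proof.
move=> [l [lG ->]] [l' [lG' ->]]; exists (l ++ l'); rewrite big_cat; split=> //.
by move=> cg; rewrite mem_cat => /orP[/lG|/lG'].
Qed.

Lemma spanFZ G (c : C) x : spanF G x -> spanF G (cstF c * x).
Proof.
move=> [l [lG ->]]; exists [seq (c * cg.1, cg.2) | cg <- l]; split.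
  by move=> _ /mapP[cg /lG H ->].
rewrite big_map mulr_sumr; apply: eq_bigr => cg _ /=.
by rewrite cstFM mulrA.
Qed.

Lemma spanF_ind G Q : Q 0 -> (forall x y, Q x -> Q y -> Q (x + y)) ->
  (forall c x, Q x -> Q (cstF c * x)) -> (forall x, G x -> Q x) ->
  forall x, spanF G x -> Q x.
Proof.
move=> Q0 QD Qc QG _ [l [lG ->]]; elim: l lG => [|cg l IH] lG.
  by rewrite big_nil.
rewrite big_cons; apply: QD.
  by apply/Qc/QG/lG; rewrite mem_head.
by apply: IH => c' lc'; apply: lG; rewrite inE lc' orbT.
Qed.

End Span.

(** * The bound along chains, for the given [u] *)

Section Main.
Context {C : numClosedFieldType}.
Context (theta r1 r2 omega c : C) (m : C -> int) (supp : seq C).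
Context (roots12 : theta%:P - ('X + 1) ^+ 2 = - (('X - r1%:P) * ('X - r2%:P))).
Context (r1_lt : 'Re r1 + 2%:R < omega) (r2_lt : 'Re r2 + 2%:R < omega).
Context (supp_uniq : uniq supp) (m_supp : forall t, m t != 0 -> t \in supp).
Context (supp_omega : forall t, t \in supp -> in_Comega omega t).
Context (c_neq0 : c != 0).
Implicit Types (z s t w : C) (x y b : @Fh C) (T : @Fh C -> Prop).

Local Notation u := (cstF c * \prod_(t <- supp) (@hF C - cstF t) ^ (m t)).
Local Notation A := (Asum m supp).
Local Notation B := (Bsum m supp).
Local Notation N := (Nroots r1 r2).
Local Notation o := (ordP r1 r2).
Local Notation d := (bound r1 r2 m supp).

Lemma sum_delta z : \sum_(s <- supp) m s * (s == z)%:Z = m z.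
Proof.
have [zs|zs] := boolP (z \in supp).
  rewrite (bigD1_seq z) //= eqxx mulr1 big1 ?addr0 // => s /negbTE->.
  by rewrite mulr0.
rewrite big1_seq; last first.
  move=> s /= ss; have [E|_] := eqVneq s z; last by rewrite mulr0.
  by rewrite -E ss in zs.
by apply/esym/eqP; apply: contraNT zs => /m_supp.
Qed.

Lemma Asum_rec z : A (z + 2%:R) = A z + m (z + 2%:R).
Proof.
rewrite /Asum -(sum_delta (z + 2%:R)) -big_split /=; apply: eq_bigr => s _.
by rewrite inNS inN22 mulrDr addrC eq_sym.
Qed.

Lemma Bsum_rec z : B z = B (z + 2%:R) + m (z + 2%:R).
Proof.
rewrite /Bsum -(sum_delta (z + 2%:R)) -big_split /=; apply: eq_bigr => s _.
by rewrite inNS mulrDr addrC.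
Qed.

(** By [Comega_inj], [s] is the only support point on the chain of [z]; lying at or to the left of
    [z], it contributes to [A] and not to [B]. *)
Lemma Asum_inN z s : s \in supp -> inN z s -> A z = m s /\ B z = 0.
Proof.
move=> ss /inNP[k zE]; split.
  rewrite -(sum_delta s); apply: eq_big_seq => t ts.
  congr (_ * (nat_of_bool _)%:Z).
  apply/inNP/eqP => [[l]|->]; last by exists k.
  by rewrite zE => /(Comega_inj omega) [] //; apply: supp_omega.
apply: big1_seq => t /= ts; case: inNP => [[l tE]|]; last by rewrite mulr0.
have /(Comega_inj omega) [] : t + (2 * 0)%:R = s + (2 * (k + 1 + l))%:R.
- by rewrite tE zE; ring.
- exact: supp_omega.
- exact: supp_omega.
by lia.
Qed.

Lemma Bsum_inN z s : s \in supp -> inN s (z + 2%:R) -> B z = m s /\ A z = 0.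
Proof.
move=> ss /inNP[k sE]; split.
  rewrite -(sum_delta s); apply: eq_big_seq => t ts.
  congr (_ * (nat_of_bool _)%:Z).
  apply/inNP/eqP => [[l tE]|->]; last by exists k.
  have /(Comega_inj omega) [] // : t + (2 * k)%:R = s + (2 * l)%:R.
  - by rewrite sE tE addrAC.
  - exact: supp_omega.
  - exact: supp_omega.
apply: big1_seq => t /= ts; case: inNP => [[l zE]|]; last by rewrite mulr0.
have /(Comega_inj omega) [] : s + (2 * 0)%:R = t + (2 * (k + 1 + l))%:R.
- by rewrite sE zE; ring.
- exact: supp_omega.
- exact: supp_omega.
by lia.
Qed.

Lemma Asum_neq0 z : A z != 0 ->
  exists s, [/\ s \in supp, inN z s, A z = m s & B z = 0].
Proof.
have [/hasP[s ss zs] _|/hasPn H] := boolP (has (inN z) supp).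
  by exists s; have [-> ->] := Asum_inN z s ss zs.
rewrite /Asum big1_seq ?eqxx // => s /= /H /negbTE->; exact: mulr0.
Qed.

Lemma Bsum_neq0 z : B z != 0 ->
  exists s, [/\ s \in supp, inN s (z + 2%:R), B z = m s & A z = 0].
Proof.
have [/hasP[s ss zs] _|/hasPn H] :=
  boolP (has (fun s => inN s (z + 2%:R)) supp).
  by exists s; have [-> ->] := Bsum_inN z s ss zs.
rewrite /Bsum big1_seq ?eqxx // => s /= /H /negbTE->; exact: mulr0.
Qed.

(** Points of [s + 2 N] have real part at least [omega], and the roots lie strictly left of that. *)
Lemma Nroots_eq0 z s : s \in supp -> inN z s -> N z = 0.
Proof.
move=> /supp_omega/andP[os _] /inNP[k ->].
have H r : 'Re r + 2%:R < omega -> inN r (s + (2 * k)%:R) = false.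
  move=> ro; apply/negbTE/inNP => -[l /eqP]; rewrite -addrA -natrD.
  apply/negP; apply: Re_lt_neq; apply: lt_le_trans os.
  by apply: le_lt_trans ro; rewrite lerDl.
by rewrite /Nroots !H.
Qed.

(** When [z + 2] is a support point, [A z = 0] and the gain [- m (z + 2)] is exactly [- A (z + 2)];
    otherwise [d] can only grow to the right, as [N] decreases. *)
Lemma bound_e z : d z - m (z + 2%:R) <= d (z + 2%:R).
Proof.
have RA := Asum_rec z; have RB := Bsum_rec z; have RN := Nroots_rec r1 r2 z.
have N0 := ordP_ge0 r1 r2 z.
have H : m (z + 2%:R) != 0 -> A z = 0.
  move=> /m_supp ss; have [E _] := Asum_inN _ _ ss (inN_refl _); lia.
rewrite /bound; lia.
Qed.

(** When [z + 2] is a support point, [B] and [N] vanish there, and [m (z + 2) - o z] is exactly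
    [B z - N z]. *)
Lemma bound_f z : d (z + 2%:R) + m (z + 2%:R) - o z <= d z.
Proof.
have RA := Asum_rec z; have RB := Bsum_rec z; have RN := Nroots_rec r1 r2 z.
have N0 := ordP_ge0 r1 r2 z.
have H : m (z + 2%:R) != 0 -> B (z + 2%:R) = 0 /\ N (z + 2%:R) = 0.
  move=> /m_supp ss; have [_ ->] := Asum_inN _ _ ss (inN_refl _).
  by rewrite (Nroots_eq0 _ _ ss (inN_refl _)).
rewrite /bound; lia.
Qed.

(** The count in (iii) starts at [s - 4]; it still sees every root in [z + 2 N], since a root has
    real part below [Re s - 2]. *)
Lemma Nroots_between z s (i : nat) :
  s \in supp -> z = s - (2 * i)%:R -> (0 < i)%N ->
  N z = (nroots_between r1 r2 s i)%:Z.
Proof.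
move=> /supp_omega/andP[os _] zE i0.
have H r : 'Re r + 2%:R < omega ->
    has (fun l => r == s - (2 * l)%:R) (iota 2 i.-1) = inN r z.
  move=> ro; apply/hasP/inNP => [[l]|[k rE]].
    rewrite mem_iota => li /eqP->; exists (i - l)%N.
    rewrite zE -addrA; congr (_ + _); apply/esym/eqP; rewrite addrC subr_eq addrC.
    rewrite -natrB ?eqr_nat; lia.
  have sE : s + (2 * k)%:R = r + (2 * i)%:R by rewrite rE zE addrAC subrK.
  (* With [r = s - 2 (i - k)], the gap [Re r + 2 < Re s] forces [i - k >= 2], the first index of the
     [iota]. *)
  have ki : (k.+2 <= i)%N.
    have {}sE : 'Re s + (2 * k)%:R = 'Re r + (2 * i)%:R by rewrite -!Re_addn sE.
    have : 'Re r + 2%:R + (2 * k)%:R < 'Re r + (2 * i)%:R.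
      by rewrite -sE ltrD2r; apply: lt_le_trans os.
    rewrite -addrA -natrD ltrD2l ltr_nat; lia.
  exists (i - k)%N; first by rewrite mem_iota; lia.
  rewrite eq_sym subr_eq eq_sym -(inj_eq (addIr (2 * k)%:R)) sE -addrA -natrD.
  by apply/eqP; congr (_ + _%:R); lia.
by rewrite /Nroots /nroots_between /= !H // addn0 PoszD.
Qed.

Lemma has_ord_u z : has_ord z (m z) u.
Proof.
rewrite -(sum_delta) -[X in has_ord _ X]add0r.
apply: has_ordM; first exact: has_ord_cst.
by apply: has_ord_prod => t; apply/has_ordX/has_ord_lin.
Qed.

(** * Polar elements and their equality with [K_u] *)

Let polar b := forall z, pole_le z (d z) b.

Lemma polar_poly (p : {poly C}) : polar (polyF p).
Proof.
by move=> z; apply: pole_leW; [apply: bound_ge0 | apply: pole_le_poly].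
Qed.

Lemma polar0 : polar 0.
Proof. by have := polar_poly 0; rewrite rmorph0. Qed.

Lemma polarD x y : polar x -> polar y -> polar (x + y).
Proof. by move=> px py z; apply: pole_leD. Qed.

Lemma polar_mulp (p : {poly C}) x : polar x -> polar (polyF p * x).
Proof.
by move=> px z; rewrite -[d z]add0r; apply: pole_leM; [apply: pole_le_poly|].
Qed.

Lemma polar_submodule : is_submodule theta u polar.
Proof.
split; first exact: polar0.
split; first exact: polarD.
split; first by move=> a x; apply: polar_mulp.
split; first by move=> x; apply: polar_mulp.
split=> x px z.
  have := pole_le_e u (z - 2%:R) _ (m z) x; rewrite subrK => /(_ (d (z - 2%:R))).
  move=> /(_ (has_ord_u z) (px _)); apply: pole_leW.
  have := bound_e (z - 2%:R).
  by rewrite subrK.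
have := pole_le_f theta r1 r2 roots12 u z _ _ x (has_ord_u _) (px _).
apply: pole_leW.
exact: bound_f.
Qed.

Lemma linF_shift s w : hF - cstF s - cstF w = hF - cstF (s + w) :> @Fh C.
Proof. by rewrite cstFD opprD addrA. Qed.

Lemma linF_shiftN s w : hF - cstF s + cstF w = hF - cstF (s - w) :> @Fh C.
Proof. by rewrite cstFD cstFN opprD opprK addrA. Qed.

(** A negative [A z] comes from a support point at or left of [z] and gives a generator (ii);
    otherwise [d z > 0] forces [B z > 0], which gives a generator (iii). *)
Lemma Ku_gen_pole z : 0 < d z ->
  Ku_gen m r1 r2 ((hF - cstF z) ^ (- d z)).
Proof.
move=> d0; have N0 := Nroots_ge0 r1 r2 z.
have [k dk] : exists k : nat, d z = k%:Z by exists (absz (d z)); lia.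
rewrite dk -exprnN; right.
have [A0|A0] := boolP (A z < 0).
  have [|s [ss /inNP[i zE] As Bs]] := Asum_neq0 z.
    by lia.
  left; exists s, i, k; rewrite linF_shift -zE; split; first by rewrite -As.
  split; first by lia.
  by split=> //; rewrite -dk /bound -As; lia.
have [|s [ss /inNP[i sE] Bs As]] := Bsum_neq0 z.
  by move: d0; rewrite /bound; lia.
(* [B z] looks at [s] in [z + 2 + 2 N], so the index is shifted by one and is positive as (iii)
   demands. *)
have zE : z = s - (2 * i.+1)%:R by rewrite sE; ring.
right; exists s, i.+1, k; rewrite linF_shiftN -zE.
have NE := Nroots_between z s i.+1 ss zE isT.
by move: dk d0; rewrite /bound -Bs -NE => dk d0; do 4 (split; first lia).
Qed.

Lemma inv_lin_polar w (k : nat) : k%:Z <= d w -> polar ((hF - cstF w) ^+ k)^-1.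
Proof.
move=> kd z.
have := has_ord_pole _ _ _ (has_ordV _ _ _ (has_ordX z _ k _ (has_ord_lin z w))).
rewrite opprK exprnP; apply: pole_leW.
have [<-|_] := eqVneq w z; first by rewrite mulr1.
by rewrite mulr0; apply: bound_ge0.
Qed.

Lemma Ku_polar b : Ku m r1 r2 b -> polar b.
Proof.
apply: spanF_ind; [exact: polar0 | exact: polarD | |].
  by move=> a x; apply: polar_mulp.
move=> _ [[p ->]|[[s [i [k [ms [k1 [km ->]]]]]]|
  [s [i [k [ms [i0 [k1 [km ->]]]]]]]]].
- exact: polar_poly.
- rewrite linF_shift; apply: inv_lin_polar.
  have ss : s \in supp by apply: m_supp; lia.
  have [||AE _] := Asum_inN (s + (2 * i)%:R) s; first exact: ss.
    by apply/inNP; exists i.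
  by rewrite /bound; lia.
- rewrite linF_shiftN; apply: inv_lin_polar.
  have ss : s \in supp by apply: m_supp; lia.
  have [||BE _] := Bsum_inN (s - (2 * i)%:R) s; first exact: ss.
    apply/inNP; exists i.-1; case: i i0 {km} => // i _ /=; ring.
  have := Nroots_between _ _ _ ss erefl i0; rewrite /bound BE => ->; lia.
Qed.

Lemma Ku_poly (p : {poly C}) : Ku m r1 r2 (polyF p).
Proof. by apply: spanF_gen; left; exists p. Qed.

(** Writing [h = (h - w) + w] lowers the exponent of one term by 1; the exponents allowed at a point
    are closed downwards, and exponent 0 gives the polynomial 1. *)
Lemma Ku_hF x : Ku m r1 r2 x -> Ku m r1 r2 (hF * x).
Proof.
have H w (k : nat) : hF * ((hF - cstF w) ^+ k.+1)^-1 =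
    ((hF - cstF w) ^+ k)^-1 + cstF w * ((hF - cstF w) ^+ k.+1)^-1 :> @Fh C.
  have l0 := linF_neq0 w.
  rewrite -{1}[hF](subrK (cstF w)) mulrDl; congr (_ + _).
  by rewrite exprS invfM mulrA mulfV // mul1r.
apply: (spanF_ind (Ku_gen m r1 r2) (fun x => Ku m r1 r2 (hF * x))).
- by rewrite mulr0; apply: spanF0.
- by move=> y y' hy hy'; rewrite mulrDr; apply: spanFD.
- by move=> a y hy; rewrite mulrCA; apply: spanFZ.
move=> y yG; have Ky := spanF_gen _ _ yG.
case: yG Ky => [[p ->]|[[s [i [[|k] [ms [// k1 [km ->]]]]]]|
  [s [i [[|k] [ms [i0 [// k1 [km ->]]]]]]]]] Ky.
- by rewrite -rmorphM; apply: Ku_poly.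
- rewrite linF_shift in Ky *; rewrite H; apply: spanFD; last exact: spanFZ.
  apply: spanF_gen; case: k k1 km {Ky} => [|k] _ km.
    by left; exists 1; rewrite rmorph1 expr0 invr1.
  by right; left; exists s, i, k.+1; rewrite linF_shift; do 3 (split; first lia).
- rewrite linF_shiftN in Ky *.
  rewrite H; apply: spanFD; last exact: spanFZ.
  apply: spanF_gen; case: k k1 km {Ky} => [|k] _ km.
    by left; exists 1; rewrite rmorph1 expr0 invr1.
  right; right; exists s, i, k.+1.
  by rewrite linF_shiftN; do 4 (split; first lia).
Qed.

Lemma Ku_hsubmodule : is_hsubmodule (Ku m r1 r2).
Proof.
split; [exact: spanF0 | exact: spanFD |] => p x Kx.
elim/poly_ind: p => [|p a IH]; first by rewrite rmorph0 mul0r; apply: spanF0.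
rewrite rmorphD rmorphM /= mulrDl [polyF p * _]mulrC -mulrA.
by apply: spanFD; [apply: Ku_hF | apply: spanFZ].
Qed.

Lemma polar_Ku b : polar b -> Ku m r1 r2 b.
Proof.
apply: local_global Ku_hsubmodule _ => z.
have [d0|d0] := boolP (0 < d z).
  by exists ((hF - cstF z) ^ (- d z)); [exact: has_ord_linX|];
    exact/spanF_gen/Ku_gen_pole.
have -> : d z = 0 by have := bound_ge0 r1 r2 m supp z; lia.
exists (polyF 1); last exact: Ku_poly.
by apply: has_ord_poly; rewrite hornerC oner_eq0.
Qed.

(** * Pole orders reached inside a nonzero submodule [T] *)

Section Reach.
Context (T : @Fh C -> Prop) (Tsub : is_submodule theta u T).
Context (Tneq0 : exists x, T x /\ x != 0).

Lemma reach_e z n : reach T z n -> reach T (z + 2%:R) (n - m (z + 2%:R)).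
Proof.
move=> [b bn Tb]; exists (act_e u b); last first.
  by case: Tsub => _ [_ [_ [_ [Te _]]]]; apply: Te.
by rewrite opprB [_ - n]addrC; apply: has_ord_e => //; apply: has_ord_u.
Qed.

Lemma reach_f z n : reach T (z + 2%:R) n -> reach T z (n + m (z + 2%:R) - o z).
Proof.
move=> [b bn Tb]; exists (act_f theta u b); last first.
  by case: Tsub => _ [_ [_ [_ [_ Tf]]]]; apply: Tf.
by rewrite opprB opprD; apply: (has_ord_f theta r1 r2) => //; apply: has_ord_u.
Qed.

Lemma Tpoly : exists2 p : {poly C}, p != 0 & T (polyF p).
Proof.
have [x [Tx x0]] := Tneq0; have [p [q [q0 xE]]] := fracP x.
have [_ _ Tp] := submodule_hsubmodule _ _ _ Tsub.
exists p; first by apply: contraNneq x0 => p0; rewrite xE p0 rmorph0 mul0r.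
by have := Tp q _ Tx; rewrite xE mulrC divfK ?polyF_eq0.
Qed.

(** A nonzero polynomial in [T] has order 0 off its finitely many roots, which form [rs]. *)
Lemma reach0 : exists rs : seq C, forall z, z \notin rs -> reach T z 0.
Proof.
have [p p0 Tp] := Tpoly; have [rs pE] := closed_field_poly_normal p.
exists rs => z zrs; exists (polyF p) => //; rewrite oppr0; apply: has_ord_poly.
rewrite -/(root p z) pE rootZ ?lead_coef_eq0 //.
by rewrite root_prod_XsubC.
Qed.

(** Far to the left, beyond [supp] and [rs], [A] is 0 and order 0 is reached; each [e] then changes
    the order by the increment of [- A]. *)
Lemma reach_Asum z : reach T z (- A z).
Proof.
have [rs rsP] := reach0.
have [K HK] := eventually_notin (fun k w => inN (z - (2 * k)%:R) w)
  (supp ++ rs) (inN_left z).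
have {HK} HK w : w \in supp ++ rs -> ~~ inN (z - (2 * K)%:R) w by apply: HK.
have : reach T (z - (2 * K)%:R) (- A (z - (2 * K)%:R)).
  have -> : A (z - (2 * K)%:R) = 0.
    apply: big1_seq => s /= ss; rewrite (negbTE (HK _ _)) ?mulr0 //.
    by rewrite mem_cat ss.
  rewrite oppr0; apply: rsP; apply/negP => zrs.
  have := HK (z - (2 * K)%:R); rewrite mem_cat zrs orbT => /(_ isT).
  by rewrite inN_refl.
elim: {HK} K => [|K IH] H; first by rewrite muln0 subr0 in H.
apply: IH; have := reach_e _ _ H; rewrite -opprD -Asum_rec.
suff -> : z - (2 * K.+1)%:R + 2%:R = z - (2 * K)%:R by [].
by ring.
Qed.

(** Mirror image with [f], starting far to the right, beyond [r1] and [r2] as well, so that [N]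
    vanishes too. *)
Lemma reach_Bsum z : reach T z (B z - N z).
Proof.
have [rs rsP] := reach0.
have [K HK] := eventually_notin (fun k w => inN w (z + (2 * k)%:R))
  (supp ++ rs ++ [:: r1; r2]) (inN_right z).
have {HK} HK w :
  w \in supp ++ rs ++ [:: r1; r2] -> ~~ inN w (z + (2 * K)%:R) by apply: HK.
have : reach T (z + (2 * K)%:R) (B (z + (2 * K)%:R) - N (z + (2 * K)%:R)).
  have -> : B (z + (2 * K)%:R) = 0.
    apply: big1_seq => s /= ss; have : ~~ inN s (z + (2 * K)%:R).
      by apply: HK; rewrite mem_cat ss.
    by move=> sz; rewrite (negbTE (contra (inN_step _ _) sz)) mulr0.
  have -> : N (z + (2 * K)%:R) = 0.
    by rewrite /Nroots !(negbTE (HK _ _)) // !mem_cat !inE eqxx !orbT.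
  rewrite subr0; apply: rsP; apply/negP => zrs.
  have := HK (z + (2 * K)%:R); rewrite !mem_cat zrs !orbT => /(_ isT).
  by rewrite inN_refl.
elim: {HK} K => [|K IH] H; first by rewrite muln0 addr0 in H.
apply: IH.
have := reach_f (z + (2 * K)%:R)
  (B (z + (2 * K.+1)%:R) - N (z + (2 * K.+1)%:R)).
have -> : z + (2 * K)%:R + 2%:R = z + (2 * K.+1)%:R by ring.
move=> /(_ H); congr reach.
have := Bsum_rec (z + (2 * K)%:R); have := Nroots_rec r1 r2 (z + (2 * K)%:R).
have -> : z + (2 * K)%:R + 2%:R = z + (2 * K.+1)%:R by ring.
by lia.
Qed.

(** The entry 0 of the maximum is covered by the other two: either [A z = 0], or [A z != 0] and then
    [B z = N z = 0]. *)
Lemma reach_bound z : reach T z (d z).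
Proof.
have hT := submodule_hsubmodule _ _ _ Tsub.
have RA := reach_Asum z; have RB := reach_Bsum z.
have [dA|dA] := boolP (d z <= - A z); first exact: reachW RA.
apply: reachW RB => //; have [A0|A0] := eqVneq (A z) 0.
  by move: dA; rewrite /bound A0; lia.
have [s [ss zs AE BE]] := Asum_neq0 z A0.
by move: dA; rewrite /bound BE (Nroots_eq0 z s ss zs); lia.
Qed.

Lemma Ku_sub_submodule b : Ku m r1 r2 b -> T b.
Proof.
move=> /Ku_polar; apply: local_global => //; last exact: reach_bound.
exact: submodule_hsubmodule Tsub.
Qed.

End Reach.

(** * Identification of the simple submodule *)

Lemma KuE b : Ku m r1 r2 b <-> polar b.
Proof. by split; [apply: Ku_polar | apply: polar_Ku]. Qed.

(** [K_u] is a nonzero submodule lying in every nonzero one: it is therefore simple, and a simple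
    [S] contains it and must equal it. *)
Lemma simple_submodule_Ku (S : @Fh C -> Prop) :
  is_simple_submodule theta u S <-> (forall b, S b <-> Ku m r1 r2 b).
Proof.
have Ku_sub : is_submodule theta u (Ku m r1 r2).
  have -> : Ku m r1 r2 = polar by apply/funext => b; apply/propext/KuE.
  exact: polar_submodule.
have Ku1 : Ku m r1 r2 1 by rewrite -(rmorph1 (@polyF C)); apply: Ku_poly.
split=> [[Ssub Sneq0 Smin]|SK].
  have KS b : Ku m r1 r2 b -> S b by apply: Ku_sub_submodule.
  have [Ku0|] := Smin _ Ku_sub KS; last by split; [auto | apply: KS].
  by have := oner_neq0 (@Fh C); rewrite (Ku0 1 Ku1) eqxx.
have -> : S = Ku m r1 r2 by apply/funext => b; apply/propext/SK.
split=> //; first by exists 1; rewrite oner_neq0.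
move=> T Tsub _; have [Tneq0|T0] := pselect (exists x, T x /\ x != 0).
  by right; apply: Ku_sub_submodule.
by left => x Tx; apply/eqP; apply: contraT => x0; case: T0; exists x.
Qed.

End Main.
Theorem theorem9 (R : realType) (theta r1 r2 c : R[i]) (m : R[i] -> int)
    (supp : seq R[i]) :
  (* r1, r2: the roots, with multiplicity, of theta - (h+1)^2 *)
  theta%:P - ('X + 1) ^+ 2 = - (('X - r1%:P) * ('X - r2%:P)) ->
  let omega := 3%:R + Num.max ('Re r1) ('Re r2) in
  (* m : C_omega -> Z of finite support (contained in supp) *)
  uniq supp ->
  (forall t, m t != 0 -> t \in supp) ->
  (forall t, t \in supp -> in_Comega omega t) ->
  c != 0 ->
  let u : @Fh R[i] := cstF c * \prod_(t <- supp) (@hF R[i] - cstF t) ^ (m t) in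
  (* K_u is the unique simple U_theta-submodule L_u of N_u *)
  forall S : @Fh R[i] -> Prop,
    is_simple_submodule theta u S <-> (forall b, S b <-> Ku m r1 r2 b).
Proof.
move=> roots12 omega supp_uniq m_supp supp_omega c_neq0 u S.
(* The 3 in [omega] exceeds the strict gap of 2 that separates the roots from the strip. *)
have H r : 'Re r <= Num.max ('Re r1) ('Re r2) -> 'Re r + 2%:R < omega.
  by move=> rm; rewrite addrC; apply: ltr_leD => //; rewrite ltr_nat.
(* The maximum is taken in the partially ordered complex field, so comparability of the two real
   parts has to be supplied. *)
have r12 : ('Re r1 >=< 'Re r2)%O by apply: real_comparable; apply: Creal_Re.
apply: (simple_submodule_Ku _ _ _ omega) => //; apply: H.
  by rewrite comparable_le_max // lexx.
by rewrite comparable_le_max // lexx orbT.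
Qed.
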